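(* Consider the MA$(2)$ model with $n=3$ sample points $\mathbf y=(y_1,y_2,y_3)^\top\in\mathbb R^3$. The implicit maximum likelihood degree is $2$, i.e. for generic $\mathbf y$ the log-likelihood $\ell(\gamma_0,\gamma_1,\gamma_2)$ has exactly two complex critical points. Put $$D=(y_1-2y_2+y_3)(y_1+2y_2+y_3),$$ $$\delta=y_1^4-4y_1^2y_2^2+y_2^4+6y_1y_2^2y_3-y_1^2y_3^2-4y_2^2y_3^2+y_3^4 .$$ If $D\neq0$, the two (not necessarily real) solutions are given precisely by (same choice of sign $\pm$ in all three formulas) $$\gamma_0=\frac{y_1^4-10y_2^4+2y_1^3y_3+2y_1y_2^2y_3+2y_1^2y_3^2+2y_1y_3^3+y_3^4\pm\big((y_1+y_3)^2+2y_2^2\big)\sqrt{\delta}}{6D},$$ $$\gamma_1=y_2(y_1+y_3)\,\frac{y_1^2-3y_2^2+y_1y_3+y_3^2\pm\sqrt\delta}{2D},$$ $$\gamma_2=\frac{y_1^2y_2^2-2y_2^4+y_1^3y_3-4y_1y_2^2y_3+2y_1^2y_3^2+y_2^2y_3^2+y_1y_3^3\pm2y_2^2\sqrt\delta}{2D}.$$ Special case I: if $y_1+2y_2+y_3=0$, the unique solution is $$\gamma_0=\frac{y_3^2+2y_2y_3-5y_2^2}{6},\quad\gamma_1=y_2^2,\quad\gamma_2=-\frac{y_3^2+2y_2y_3+3y_2^2}{2}.$$ Special case II: if $y_1-2y_2+y_3=0$, the unique solution is $$\gamma_0=\frac{y_3^2-2y_2y_3-5y_2^2}{6},\quad\gamma_1=-y_2^2,\quad\gamma_2=-\frac{y_3^2-2y_2y_3+3y_2^2}{2}.$$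 Here, in each case, a listed triple with $\det\Sigma(\gamma)=0$ is to be discarded: the complex critical points of $\ell$ are exactly those listed triples for which $\det\Sigma(\gamma)\ne0$.
   Context: For an MA$(2)$ process $Y_t=a_0Z_t+a_1Z_{t-1}+a_2Z_{t-2}$ ($Z_t$ i.i.d. standard normal) with autocovariances $\gamma_0,\gamma_1,\gamma_2$, the covariance matrix of $(Y_1,Y_2,Y_3)$ is $$\Sigma(\gamma)=\begin{pmatrix}\gamma_0&\gamma_1&\gamma_2\\\gamma_1&\gamma_0&\gamma_1\\\gamma_2&\gamma_1&\gamma_0\end{pmatrix},\qquad \det\Sigma(\gamma)=(\gamma_0-\gamma_2)\big(\gamma_0(\gamma_0+\gamma_2)-2\gamma_1^2\big).$$ The log-likelihood in the coordinates $\gamma=(\gamma_0,\gamma_1,\gamma_2)$ is (up to constants) $\ell(\gamma)=-\log\det\Sigma(\gamma)-\mathbf y^\top\Sigma(\gamma)^{-1}\mathbf y$. Its complex critical points (''solutions'') are the $\gamma\in\mathbb C^3$ with $\det\Sigma(\gamma)\neq0$ and $$-\operatorname{tr}\Big(\Sigma^{-1}\frac{\partial\Sigma}{\partial\gamma_h}\Big)+\mathbf y^\top\Sigma^{-1}\frac{\partial\Sigma}{\partial\gamma_h}\Sigma^{-1}\mathbf y=0,\qquad h=0,1,2.$$ The implicit maximum likelihood degree is the number of such critical points for generic $\mathbf y$ (outside some proper algebraic subset). $\sqrt\delta$ denotes a fixed complex square root of $\delta$. *)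

(* Defs.v *)
From HB Require Import structures.
From mathcomp Require Import all_boot all_order all_algebra.
From mathcomp Require Import reals complex.
From mathcomp Require Import mpoly.

Set Implicit Arguments.
Unset Strict Implicit.
Unset Printing Implicit Defensive.

Import GRing.Theory Num.Theory.
Local Open Scope ring_scope.

Definition col3 (T : nmodType) (a b c : T) : 'cV[T]_3 :=
  \col_(i < 3) [:: a; b; c]`_i.

(* Cov(Y_i, Y_j) = gamma_{|i - j|}; [inord] is exact since |i - j| <= 2. *)
Definition Sigma (T : Type) (g : 'cV[T]_3) : 'M[T]_3 :=
  \matrix_(i < 3, j < 3) g (inord `|i - j|%N) 0.

(* The partial derivative of the matrix-valued polynomial map Sigma with
   respect to gamma_h, at g: coordinate h is replaced by the indeterminate, the
   other coordinates are frozen at their values in g, and the entrywise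
   derivative is evaluated at g_h. *)
Definition dSigma (F : fieldType) (g : 'cV[F]_3) (h : 'I_3) : 'M[F]_3 :=
  map_mx (fun p : {poly F} => p^`().[g h 0])
    (Sigma (\col_(k < 3) if k == h then 'X else (g k 0)%:P)).

(* The partial derivative with respect to gamma_h of
   l(gamma) = - log det Sigma(gamma) - y^T Sigma(gamma)^-1 y. *)
Definition score (F : fieldType) (y g : 'cV[F]_3) (h : 'I_3) : F :=
  - \tr (invmx (Sigma g) *m dSigma g h)
  + (y^T *m invmx (Sigma g) *m dSigma g h *m invmx (Sigma g) *m y) 0 0.

Definition critical_point (R : realType) (y : 'cV[R]_3) (g : 'cV[R[i]]_3) :
    Prop :=
  \det (Sigma g) != 0 /\
  forall h : 'I_3, score (map_mx (real_complex R) y) g h = 0.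

Definition algebraic_set (R : realType) (V : 'cV[R]_3 -> Prop) : Prop :=
  exists ps : seq {mpoly R[3]},
    forall y, V y <-> (forall p, p \in ps -> p.@[fun i => y i 0] = 0).

Definition generically (R : realType) (P : 'cV[R]_3 -> Prop) : Prop :=
  exists V : 'cV[R]_3 -> Prop,
    [/\ algebraic_set V, exists y, ~ V y & forall y, ~ V y -> P y].

Definition has_n_critical_points (R : realType) (n : nat) (y : 'cV[R]_3) :
    Prop :=
  exists s : seq 'cV[R[i]]_3,
    [/\ uniq s, size s = n & forall g, critical_point y g <-> g \in s].

Definition implicit_ml_degree_is (R : realType) (n : nat) : Prop :=
  generically (fun y : 'cV[R]_3 => has_n_critical_points n y).

Section Formulas.
Variables (F : fieldType) (y1 y2 y3 : F).

Definition D_poly : F := (y1 - 2 * y2 + y3) * (y1 + 2 * y2 + y3).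

Definition delta_poly : F :=
  y1 ^+ 4 - 4 * y1 ^+ 2 * y2 ^+ 2 + y2 ^+ 4 + 6 * y1 * y2 ^+ 2 * y3
  - y1 ^+ 2 * y3 ^+ 2 - 4 * y2 ^+ 2 * y3 ^+ 2 + y3 ^+ 4.

(* s plays the role of +/- sqrt delta. *)
Definition gamma0 (s : F) : F :=
  (y1 ^+ 4 - 10 * y2 ^+ 4 + 2 * y1 ^+ 3 * y3 + 2 * y1 * y2 ^+ 2 * y3
   + 2 * y1 ^+ 2 * y3 ^+ 2 + 2 * y1 * y3 ^+ 3 + y3 ^+ 4
   + ((y1 + y3) ^+ 2 + 2 * y2 ^+ 2) * s) / (6 * D_poly).

Definition gamma1 (s : F) : F :=
  y2 * (y1 + y3) *
  ((y1 ^+ 2 - 3 * y2 ^+ 2 + y1 * y3 + y3 ^+ 2 + s) / (2 * D_poly)).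

Definition gamma2 (s : F) : F :=
  (y1 ^+ 2 * y2 ^+ 2 - 2 * y2 ^+ 4 + y1 ^+ 3 * y3 - 4 * y1 * y2 ^+ 2 * y3
   + 2 * y1 ^+ 2 * y3 ^+ 2 + y2 ^+ 2 * y3 ^+ 2 + y1 * y3 ^+ 3
   + 2 * y2 ^+ 2 * s) / (2 * D_poly).

Definition general_solution (s : F) : 'cV[F]_3 :=
  col3 (gamma0 s) (gamma1 s) (gamma2 s).

Definition special_solution_I : 'cV[F]_3 :=
  col3 ((y3 ^+ 2 + 2 * y2 * y3 - 5 * y2 ^+ 2) / 6)
       (y2 ^+ 2)
       (- ((y3 ^+ 2 + 2 * y2 * y3 + 3 * y2 ^+ 2) / 2)).

Definition special_solution_II : 'cV[F]_3 :=
  col3 ((y3 ^+ 2 - 2 * y2 * y3 - 5 * y2 ^+ 2) / 6)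
       (- y2 ^+ 2)
       (- ((y3 ^+ 2 - 2 * y2 * y3 + 3 * y2 ^+ 2) / 2)).

End Formulas.

(* Main.v *)
(* Splitting R^3 into the antisymmetric line and the symmetric plane makes Sigma
   block diagonal, with blocks r = g0 - g2 and B = [[g0 + g2, c], [c, g0]],
   c^2 = 2 g1^2. With p = (y1 - y3)^2 / 2, w = ((y1 + y3) / sqrt 2, y2) and
   t = (p - r) / r^2, the score vanishes iff
     B^-1 w w^T B^-1 - B^-1 = diag (t, -2t),
   and by 2g0 = r + (g0 + g2) this becomes
     (1 - t r) B = w w^T + t (det B) diag (-2, 1).
   Taking determinants yields a quadratic equation for u = (1 - t r)^-1, whose
   leading coefficient is D = 2 (w1^2 - 2 w2^2) and whose discriminant is
   4 delta. Modulo this equation, g is affine in u.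
   When D = 0, only the root u = -1 has det Sigma != 0. *)
Require Import Defs.
From HB Require Import structures.
From mathcomp Require Import all_boot all_order all_algebra.
From mathcomp Require Import reals complex.
From mathcomp Require Import mpoly.
From mathcomp Require Import ring.

Set Implicit Arguments.
Unset Strict Implicit.
Unset Printing Implicit Defensive.

Import GRing.Theory Num.Theory.
Local Open Scope ring_scope.

(** * Vectors and matrices of size three; determinant and inverse of [Sigma] *)

Lemma ord3P (P : 'I_3 -> Prop) :
  P 0 -> P 1 -> P 2 -> forall i, P i.
Proof.
move=> P0 P1 P2 [[|[|[|//]]] lti3].
- by rewrite (_ : Ordinal _ = 0) //; apply/val_inj.
- by rewrite (_ : Ordinal _ = 1) //; apply/val_inj.
- by rewrite (_ : Ordinal _ = 2) //; apply/val_inj.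
Qed.

Lemma sum_ord3 (V : nmodType) (f : 'I_3 -> V) :
  \sum_i f i = f 0 + f 1 + f 2.
Proof.
rewrite 2!big_ord_recr big_ord1 /=.
by congr (f _ + f _ + f _); apply/val_inj.
Qed.

Lemma col3_eta (T : nmodType) (g : 'cV[T]_3) : g = col3 (g 0 0) (g 1 0) (g 2 0).
Proof.
apply/matrixP => i j; rewrite ord1 mxE; move: i {j}.
by apply: ord3P.
Qed.

Lemma map_col3 (T T' : nmodType) (f : T -> T') (a b c : T) :
  map_mx f (col3 a b c) = col3 (f a) (f b) (f c).
Proof.
apply/matrixP => i j; rewrite ord1 !mxE; move: i {j}.
by apply: ord3P.
Qed.

Definition mx3 (T : nmodType) (s : seq (seq T)) : 'M[T]_3 :=
  \matrix_(i, j) nth 0 (nth [::] s i) j.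

Lemma Sigma_col3 (T : nmodType) (a b c : T) :
  Sigma (col3 a b c) =
  mx3 [:: [:: a; b; c]; [:: b; a; b]; [:: c; b; a]].
Proof.
by apply/matrixP; apply: ord3P; apply: ord3P; rewrite !mxE inordK.
Qed.

Lemma dSigmaE (F : fieldType) (g : 'cV[F]_3) (h i j : 'I_3) :
  dSigma g h i j = (inord `|i - j|%N == h)%:R.
Proof.
rewrite !mxE; case: eqP => _; first by rewrite derivX hornerC.
by rewrite derivC hornerC.
Qed.

Lemma det_Sigma_col3 (F : fieldType) (a b c : F) :
  \det (Sigma (col3 a b c)) = (a - c) * (a * (a + c) - 2 * b ^+ 2).
Proof.
rewrite Sigma_col3 (expand_det_row _ 0) sum_ord3 /cofactor.
rewrite !(expand_det_row _ (0 : 'I_2)) !big_ord_recr !big_ord0 /= /cofactor.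
rewrite !det_mx11 !mxE /=.
ring.
Qed.

Lemma invmx_Sigma_col3 (F : fieldType) (a b c : F) :
  a - c != 0 -> a * (a + c) - 2 * b ^+ 2 != 0 ->
  let e := ((a - c) * (a * (a + c) - 2 * b ^+ 2))^-1 in
  let k0 := (a ^+ 2 - b ^+ 2) * e in
  let k1 := - b * (a - c) * e in
  let k2 := (b ^+ 2 - a * c) * e in
  let m := (a ^+ 2 - c ^+ 2) * e in
  invmx (Sigma (col3 a b c)) =
  mx3 [:: [:: k0; k1; k2]; [:: k1; m; k1]; [:: k2; k1; k0]].
Proof.
move=> ac_neq0 B_neq0 e k0 k1 k2 m; set K := mx3 _.
have detS : Sigma (col3 a b c) \in unitmx.
  by rewrite unitmxE det_Sigma_col3 unitfE mulf_neq0.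
suff KS : K *m Sigma (col3 a b c) = 1%:M.
  by rewrite -[LHS]mul1mx -KS mulmxK.
rewrite Sigma_col3; apply/matrixP.
apply: ord3P; apply: ord3P; rewrite !mxE sum_ord3 !mxE /=;
  rewrite /m /k0 /k1 /k2 /e; field; by rewrite B_neq0.
Qed.

(** * The score in coordinates *)

Lemma quad_form3 (F : comNzRingType) (v1 v2 v3 : F) (A : 'M[F]_3) :
  ((col3 v1 v2 v3)^T *m A *m col3 v1 v2 v3) 0 0 =
  (v1 * A 0 0 + v2 * A 1 0 + v3 * A 2 0) * v1
  + (v1 * A 0 1 + v2 * A 1 1 + v3 * A 2 1) * v2
  + (v1 * A 0 2 + v2 * A 1 2 + v3 * A 2 2) * v3.
Proof. by rewrite mxE sum_ord3 !mxE !sum_ord3 !mxE. Qed.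

(** The inverse K of [Sigma g] is symmetric, so the quadratic term of the score is v^T [dSigma] v
    with v = K y, and [dSigma] is a 0-1 Toeplitz matrix. *)
Lemma score_mx3 (F : fieldType) (y1 y2 y3 k0 k1 k2 m : F) (g : 'cV[F]_3) :
  invmx (Sigma g) =
    mx3 [:: [:: k0; k1; k2]; [:: k1; m; k1]; [:: k2; k1; k0]] ->
  let v1 := k0 * y1 + k1 * y2 + k2 * y3 in
  let v2 := k1 * y1 + m * y2 + k1 * y3 in
  let v3 := k2 * y1 + k1 * y2 + k0 * y3 in
  let sc := score (col3 y1 y2 y3) g in
  [/\ sc 0 = v1 ^+ 2 + v2 ^+ 2 + v3 ^+ 2 - (2 * k0 + m),
      sc 1 = 2 * (v1 * v2 + v2 * v3 - 2 * k1) &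
      sc 2 = 2 * (v1 * v3 - k2)].
Proof.
set K := mx3 _ => eK v1 v2 v3 sc.
have Ky : K *m col3 y1 y2 y3 = col3 v1 v2 v3.
  apply/matrixP => i j; rewrite ord1; move: i {j}.
  by apply: ord3P; rewrite !mxE sum_ord3 !mxE.
have KT : K^T = K by apply/matrixP; apply: ord3P; apply: ord3P; rewrite !mxE.
have scE h : sc h = - \tr (K *m dSigma g h) +
    ((col3 v1 v2 v3)^T *m dSigma g h *m col3 v1 v2 v3) 0 0.
  by rewrite /sc /score eK -mulmxA Ky -Ky trmx_mul KT.
have trE A : \tr (K *m A) = (k0 * A 0 0 + k1 * A 1 0 + k2 * A 2 0)
  + (k1 * A 0 1 + m * A 1 1 + k1 * A 2 1)
  + (k2 * A 0 2 + k1 * A 1 2 + k0 * A 2 2).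
  by rewrite /mxtrace sum_ord3 !mxE !sum_ord3 !mxE.
have dE h i j : dSigma g h i j = (`|i - j|%N == h :> nat)%:R.
  rewrite dSigmaE -val_eqE /= inordK //.
  by move: i j; do 2!apply: ord3P.
rewrite !scE !trE !quad_form3 !dE /=; split; ring.
Qed.

(** With v = Sigma^-1 y, [vp] = v1 + v3 and [vm] = v1 - v3. These coordinates separate the blocks:
    [vm] involves only r, while [vp] and [v2] involve only B, whose determinant is [e]. *)
Lemma score_col3 (F : numFieldType) (y1 y2 y3 a b c : F) :
  a - c != 0 -> a * (a + c) - 2 * b ^+ 2 != 0 ->
  let r := a - c in
  let e := a * (a + c) - 2 * b ^+ 2 in
  let vp := (a * (y1 + y3) - 2 * b * y2) / e in
  let v2 := ((a + c) * y2 - b * (y1 + y3)) / e in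
  let vm := (y1 - y3) / r in
  let sc := score (col3 y1 y2 y3) (col3 a b c) in
  [/\ sc 0 = vp ^+ 2 / 2 + vm ^+ 2 / 2 + v2 ^+ 2
             - (r^-1 + a / e + (a + c) / e),
      sc 1 = 2 * (vp * v2 + 2 * b / e) &
      sc 2 = (vp ^+ 2 / 2 - a / e) - (vm ^+ 2 / 2 - r^-1)].
Proof.
move=> r_neq0 e_neq0 /=.
have [-> -> ->] := score_mx3 y1 y2 y3 (invmx_Sigma_col3 r_neq0 e_neq0).
by split; field; rewrite ?e_neq0 ?r_neq0.
Qed.

(** * The matrix equation for B *)

(** [t] is the derivative in r of the antisymmetric part -log r - p/r of the likelihood. [S 2 = 0]
    equates it with the (1,1) entry of the gradient in B, and then [S 0 = 0] makes the (2,2) entry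
    -2t. *)
Lemma score_eq0_normal_equations (F : numFieldType) (y1 y2 y3 a b c : F) :
  a - c != 0 -> a * (a + c) - 2 * b ^+ 2 != 0 ->
  let t := ((y1 - y3) ^+ 2 / 2 - (a - c)) / (a - c) ^+ 2 in
  let m := t * (a * (a + c) - 2 * b ^+ 2) in
  (forall h, score (col3 y1 y2 y3) (col3 a b c) h = 0) <->
  [/\ (a + c) * (1 - t * (a - c)) = (y1 + y3) ^+ 2 / 2 - 2 * m,
      b * (1 - t * (a - c)) = (y1 + y3) * y2 / 2 &
      a * (1 - t * (a - c)) = y2 ^+ 2 + m].
Proof.
move=> r_neq0 e_neq0 t m; set S := score _ _.
have [S0 S1 S2] := score_col3 y1 y2 y3 r_neq0 e_neq0; rewrite -/S in S0 S1 S2.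
pose e := a * (a + c) - 2 * b ^+ 2.
pose E11 := (y1 + y3) ^+ 2 / 2 - 2 * m - (a + c) * (1 - t * (a - c)).
pose E12 := (y1 + y3) * y2 / 2 - b * (1 - t * (a - c)).
pose E22 := y2 ^+ 2 + m - a * (1 - t * (a - c)).
(* Writing H for the gradient of the likelihood on symmetric 2x2 matrices minus
   diag (t, -2t), the matrix E is B H B up to factors sqrt 2, and conversely
   H = B^-1 E B^-1. *)
split=> [S_eq0 | [e11 e12 e22]].
  suff [e11 e12 e22] : [/\ E11 = 0, E12 = 0 & E22 = 0].
    by split; apply/esym/subr0_eq.
  have -> : E11 = (a + c) ^+ 2 * S 2 + (a + c) * b * S 1
                  + 2 * b ^+ 2 * (S 0 - S 2).
    by rewrite S0 S1 S2 /E11 /m /t; field; rewrite ?e_neq0 ?r_neq0.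
  have -> : E12 = (a + c) * b * S 2 + ((a + c) * a + 2 * b ^+ 2) / 4 * S 1
                  + b * a * (S 0 - S 2).
    by rewrite S0 S1 S2 /E12 /m /t; field; rewrite ?e_neq0 ?r_neq0.
  have -> : E22 = 2 * b ^+ 2 * S 2 + a * b * S 1 + a ^+ 2 * (S 0 - S 2).
    by rewrite S0 S1 S2 /E22 /m /t; field; rewrite ?e_neq0 ?r_neq0.
  by rewrite !S_eq0; split; ring.
have E11_eq0 : E11 = 0 by rewrite /E11 e11 subrr.
have E12_eq0 : E12 = 0 by rewrite /E12 e12 subrr.
have E22_eq0 : E22 = 0 by rewrite /E22 e22 subrr.
have S2E : S 2 = (a ^+ 2 * E11 - 4 * a * b * E12 + 2 * b ^+ 2 * E22) / e ^+ 2.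
  by rewrite S2 /E11 /E12 /E22 /m /t /e; field; rewrite ?e_neq0 ?r_neq0.
have S0E : S 0 = S 2 +
    (2 * b ^+ 2 * E11 - 4 * (a + c) * b * E12 + (a + c) ^+ 2 * E22) / e ^+ 2.
  by rewrite S0 S2 /E11 /E12 /E22 /m /t /e; field; rewrite ?e_neq0 ?r_neq0.
have S1E : S 1 = 4 * (((a + c) * a + 2 * b ^+ 2) * E12
                      - a * b * E11 - (a + c) * b * E22) / e ^+ 2.
  by rewrite S1 /E11 /E12 /E22 /m /t /e; field; rewrite ?e_neq0 ?r_neq0.
by apply: ord3P; rewrite ?S0E ?S1E ?S2E E11_eq0 E12_eq0 E22_eq0; ring.
Qed.

(* The hand-computed cofactors [k] are certificates of ideal membership. *)
Lemma eq_of_multiple (F : comNzRingType) (k l r a b : F) :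
  l = r -> a - b = k * (l - r) -> a = b.
Proof. by move=> -> /eqP; rewrite subrr mulr0 subr_eq0 => /eqP. Qed.

(** * Parametrization of the solutions by the roots of a quadratic *)

(** Put x = t r. The definition of t gives r (1 + x) = p, and 2a - (a + c) = r gives r (1 - x) = 4m
    - q. Together with the determinant relation these express everything through u = 1 / (1 - x). *)
Lemma normal_equations_param (F : numFieldType) (p Y z a b c : F) :
  a - c != 0 -> a * (a + c) - 2 * b ^+ 2 != 0 ->
  let q := Y ^+ 2 / 2 - 2 * z ^+ 2 in
  let t := (p - (a - c)) / (a - c) ^+ 2 in
  let m := t * (a * (a + c) - 2 * b ^+ 2) in
  [/\ (a + c) * (1 - t * (a - c)) = Y ^+ 2 / 2 - 2 * m,
      b * (1 - t * (a - c)) = Y * z / 2 &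
      a * (1 - t * (a - c)) = z ^+ 2 + m] ->
  exists u, let M := (p + 4 * q * u - q) / 12 in
    [/\ 2 * q * u ^+ 2 - (p + 3 * q) * u - (p - q) = 0,
        a = z ^+ 2 * u + M,
        b = Y * z * u / 2 &
        c = Y ^+ 2 / 2 * u - z ^+ 2 * u - 3 * M].
Proof.
move=> r_neq0 e_neq0 q t m [].
set e := a * _ - _ in e_neq0 m *.
set x := t * (a - c) => E11 E12 E22.
have rx : (a - c) * (1 + x) = p by rewrite /x /t; field.
have r1x : (a - c) * (1 - x) = 4 * m - q.
  have -> : (a - c) * (1 - x) = 2 * (a * (1 - x)) - (a + c) * (1 - x) by ring.
  by rewrite E11 E22 /q; ring.
(* If x = 1, the equations read w w^T = m diag (2, -1). The left side has determinant 0, so m = 0,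
   hence t = 0 and x = 0, a contradiction. *)
have x_neq1 : 1 - x != 0.
  apply/eqP => x1; rewrite x1 !mulr0 in E11 E12 E22.
  have YY : Y ^+ 2 = 4 * m by apply: (eq_of_multiple (k := - 2) E11); field.
  have zz : z ^+ 2 = - m by apply: (eq_of_multiple (k := - 1) E22); ring.
  have m0 : m = 0.
    apply/eqP; rewrite -sqrf_eq0; apply/eqP.
    have -> : m ^+ 2 = - (4 * m * - m / 4) by field.
    by rewrite -YY -zz; apply: (eq_of_multiple (k := Y * z / 2) E12); field.
  have t0 : t = 0 by apply: (mulIf e_neq0); rewrite -/m m0 mul0r.
  by move/eqP: x1; rewrite /x t0 mul0r subr0 oner_eq0.
have xe : (1 - x) ^+ 2 = t * (q - 2 * m).
  apply: (mulfI e_neq0).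
  have -> : e * (1 - x) ^+ 2 = ((a + c) * (1 - x)) * (a * (1 - x))
                               - 2 * (b * (1 - x)) ^+ 2 by rewrite /e; ring.
  have -> : e * (t * (q - 2 * m)) = m * (q - 2 * m) by rewrite /m; ring.
  by rewrite E11 E12 E22 /q; field.
(* Multiplying [xe] by r and inserting [r1x] makes the terms in q x cancel, which leaves a relation
   linear in x. *)
have mq : 2 * m * (2 - x) = q.
  have : (1 - x) * (4 * m - q) = x * (q - 2 * m).
    by rewrite -r1x mulrCA -expr2 xe /x; ring.
  by move/(eq_of_multiple (k := 1)); apply; ring.
have r1x' : (a - c) * (1 - x) = 2 * m * x by rewrite r1x -mq; ring.
exists (1 - x)^-1; set u := (1 - x)^-1; set M := _ / 12.
have ME : M = m * u.
  apply: (mulIf x_neq1); rewrite [RHS]divfK //.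
  have -> : M * (1 - x) = ((a - c) * (1 - x) * (1 + x) + q * (3 + x)) / 12.
    by rewrite /M /u -rx; field.
  by rewrite r1x' -mq; field.
have divu k l : k * (1 - x) = l -> k = l * u.
  by move=> <-; rewrite mulfK.
split.
- apply: (mulIf (expf_neq0 2 x_neq1)); rewrite mul0r.
  transitivity (q * x * (1 + x) - (a - c) * (1 - x) * (1 + x) * (2 - x)).
    by rewrite /u -rx; field.
  by rewrite r1x' -mq; ring.
- by rewrite (divu _ _ E22) ME; ring.
- by rewrite (divu _ _ E12); ring.
- by rewrite -[c](addKr a) addrC (divu _ _ E11) [in LHS](divu _ _ E22) ME; ring.
Qed.

(** Modulo the quadratic, r satisfies two identities, [ru] and [rM]. The first yields t r = 1 - 1/u;
    with the second, m = M/u. The equations then become identities in u. *)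
Lemma param_normal_equations (F : numFieldType) (p Y z u : F) :
  let q := Y ^+ 2 / 2 - 2 * z ^+ 2 in
  let M := (p + 4 * q * u - q) / 12 in
  let a := z ^+ 2 * u + M in
  let b := Y * z * u / 2 in
  let c := Y ^+ 2 / 2 * u - z ^+ 2 * u - 3 * M in
  let t := (p - (a - c)) / (a - c) ^+ 2 in
  let m := t * (a * (a + c) - 2 * b ^+ 2) in
  2 * q * u ^+ 2 - (p + 3 * q) * u - (p - q) = 0 ->
  a - c != 0 -> a * (a + c) - 2 * b ^+ 2 != 0 ->
  [/\ (a + c) * (1 - t * (a - c)) = Y ^+ 2 / 2 - 2 * m,
      b * (1 - t * (a - c)) = Y * z / 2 &
      a * (1 - t * (a - c)) = z ^+ 2 + m].
Proof.
move=> q M a b c t m Qu r_neq0 e_neq0.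
have rE : a - c = (p + q * u - q) / 3 by rewrite /a /c /M /q; field.
have eE : a * (a + c) - 2 * b ^+ 2 = M * (u * q - 2 * M).
  by rewrite /a /b /c /q; field.
(* At u = 0 the quadratic forces p = q, so M = 0 and det B = 0. *)
have u_neq0 : u != 0.
  apply: contraNneq e_neq0 => u0; apply/eqP; rewrite eE.
  apply: (eq_of_multiple (k := 1 / 72 * (p - q)) Qu).
  by rewrite /M u0; field.
have ru : (a - c) * (2 * u - 1) = p * u.
  by apply: (eq_of_multiple (k := 1 / 3) Qu); rewrite rE; field.
have rM : a - c = (u - 1) * (u * q - 2 * M).
  by apply: (eq_of_multiple (k := - 1 / 6) Qu); rewrite rE /M; field.
have tE : t * (a - c) = 1 - u^-1.
  have -> : t * (a - c) = p * u / (u * (a - c)) - 1.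
    by rewrite /t; field; rewrite r_neq0 u_neq0.
  by rewrite -ru; field; rewrite r_neq0 u_neq0.
have mE : m = M / u.
  apply: (mulIf r_neq0).
  have -> : m * (a - c) = t * (a - c) * (a * (a + c) - 2 * b ^+ 2).
    by rewrite /m; ring.
  by rewrite tE eE [in RHS]rM; field.
by rewrite tE mE; clearbody t m; split; rewrite /a /b /c; field.
Qed.

(** * Solutions in terms of the data: nondegeneracy, closed formulas, the case D = 0 *)

Section ModelSolution.
Variables (F : numFieldType) (y1 y2 y3 : F).

(** This is p, the squared antisymmetric coordinate of y; [half_D] below is q = w1^2 - 2 w2^2. *)
Definition half_diff : F := (y1 - y3) ^+ 2 / 2.

Definition half_D : F := (y1 + y3) ^+ 2 / 2 - 2 * y2 ^+ 2.

Definition param_quadratic (u : F) : F :=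
  2 * half_D * u ^+ 2 - (half_diff + 3 * half_D) * u - (half_diff - half_D).

(* [M] is t (det B) u, reduced modulo [param_quadratic]. *)
Definition param_solution (u : F) : 'cV[F]_3 :=
  let M := (half_diff + 4 * half_D * u - half_D) / 12 in
  col3 (y2 ^+ 2 * u + M)
       ((y1 + y3) * y2 * u / 2)
       ((y1 + y3) ^+ 2 / 2 * u - y2 ^+ 2 * u - 3 * M).

Lemma score_eq0P (g : 'cV[F]_3) : \det (Sigma g) != 0 ->
  (forall h, score (col3 y1 y2 y3) g h = 0) <->
  exists u, param_quadratic u = 0 /\ g = param_solution u.
Proof.
rewrite (col3_eta g); move: (g 0 0) (g 1 0) (g 2 0) => a b c.
rewrite det_Sigma_col3 mulf_eq0 negb_or => /andP[r_neq0 e_neq0].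
apply: iff_trans (score_eq0_normal_equations _ _ _ r_neq0 e_neq0) _.
split.
  move=> E; have [u [Qu aE bE cE]] := normal_equations_param r_neq0 e_neq0 E.
  by exists u; split=> //; rewrite /param_solution -aE -bE -cE.
case=> u [Qu gE].
have coordE i := congr1 (fun g : 'cV[F]_3 => g i 0) gE.
have [aE bE cE] := And3 (coordE 0) (coordE 1) (coordE 2).
rewrite !mxE /= in aE bE cE.
move: r_neq0 e_neq0; rewrite aE bE cE => r_neq0 e_neq0.
exact: param_normal_equations Qu r_neq0 e_neq0.
Qed.

Lemma half_DE : half_D = D_poly y1 y2 y3 / 2.
Proof. by rewrite /half_D /D_poly; field. Qed.

Lemma param_solution_sub (u : F) :
  param_solution u 0 0 - param_solution u 2 0 =
  (half_diff + half_D * u - half_D) / 3.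
Proof. by rewrite !mxE /= /half_D; field. Qed.

Lemma det_param_solution (u : F) :
  let M := (half_diff + 4 * half_D * u - half_D) / 12 in
  \det (Sigma (param_solution u)) =
  (half_diff + half_D * u - half_D) / 3 * (M * (half_D * u - 2 * M)).
Proof. by rewrite det_Sigma_col3 /half_D; field. Qed.

(** Modulo the quadratic, the vanishing of the factors r, M and q u - 2M of the determinant forces p
    u = 0, q u^2 = 0 and p = q respectively; u = 0 would also give p = q. *)
Lemma det_param_solution_neq0 (u : F) :
  param_quadratic u = 0 -> half_D != 0 -> half_diff != 0 ->
  half_diff - half_D != 0 -> \det (Sigma (param_solution u)) != 0.
Proof.
rewrite det_param_solution /param_quadratic => Qu.
move: half_diff half_D Qu => p q Qu q_neq0 p_neq0 pq_neq0.
have u_neq0 : u != 0.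
  apply: contraNneq pq_neq0 => u0; apply/eqP.
  by apply: (eq_of_multiple (k := - 1) Qu); rewrite u0; ring.
rewrite !mulf_neq0 // ?invr_eq0 ?pnatr_eq0 //.
- apply: contraNneq (mulf_neq0 p_neq0 u_neq0) => r0; apply/eqP.
  apply: (eq_of_multiple (k := (2 * u - 1) / 3) r0).
  by apply: (eq_of_multiple (k := - 1 / 3) Qu); field.
- apply: contraNneq (mulf_neq0 q_neq0 (expf_neq0 2 u_neq0)) => M0; apply/eqP.
  apply: (eq_of_multiple (k := (u + 1) / 6) M0).
  by apply: (eq_of_multiple (k := 1 / 6) Qu); field.
- apply: contraNneq pq_neq0 => W0; apply/eqP.
  apply: (eq_of_multiple (k := 2 * (u - 2)) W0).
  by apply: (eq_of_multiple (k := - 1 / 3) Qu); field.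
Qed.

Lemma general_solution_param (s : F) : D_poly y1 y2 y3 != 0 ->
  general_solution y1 y2 y3 s =
  param_solution
    ((y1 ^+ 2 - 3 * y2 ^+ 2 + y1 * y3 + y3 ^+ 2 + s) / D_poly y1 y2 y3).
Proof.
move=> D_neq0; rewrite /general_solution /param_solution half_DE.
rewrite /half_diff /gamma0 /gamma1 /gamma2.
move: D_neq0; rewrite /D_poly mulf_eq0 negb_or andbC => D_neq0.
by congr col3; field.
Qed.

Lemma param_quadratic_roots (s u : F) :
  D_poly y1 y2 y3 != 0 -> s ^+ 2 = delta_poly y1 y2 y3 ->
  param_quadratic u = 0 <->
  u = (y1 ^+ 2 - 3 * y2 ^+ 2 + y1 * y3 + y3 ^+ 2 + s) / D_poly y1 y2 y3 \/
  u = (y1 ^+ 2 - 3 * y2 ^+ 2 + y1 * y3 + y3 ^+ 2 - s) / D_poly y1 y2 y3.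
Proof.
set D := D_poly _ _ _; set N := _ + y3 ^+ 2 => D_neq0 s2.
(* Completing the square: 2q = D, p + 3q = 2N and delta = N^2 + D (p - q). *)
have QE : D * param_quadratic u = (D * u - (N + s)) * (D * u - (N - s)).
  apply: (eq_of_multiple (k := 1) s2).
  rewrite /param_quadratic half_DE /half_diff /delta_poly /N /D /D_poly.
  by field.
split=> [Qu | ].
  move/eqP: QE; rewrite Qu mulr0 eq_sym mulf_eq0 !subr_eq0.
  by case/orP=> /eqP <-; [left | right]; rewrite mulrAC mulfV ?mul1r.
move=> uE; apply: (mulfI D_neq0); rewrite QE mulr0.
by case: uE => ->; rewrite mulrCA mulfV // mulr1 subrr ?mul0r ?mulr0.
Qed.

(** For q = 0 the quadratic degenerates to -p (u + 1), and p is nonzero because the determinant has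
    the factor r = p/3. *)
Lemma param_half_D0 (u : F) :
  half_D = 0 -> param_quadratic u = 0 ->
  \det (Sigma (param_solution u)) != 0 -> u = -1.
Proof.
rewrite /param_quadratic det_param_solution => -> Qu.
rewrite !mulf_eq0 !negb_or => /andP[/andP[p_neq0 _] _].
have {}p_neq0 : half_diff != 0 by move: p_neq0; rewrite mul0r subr0 addr0.
apply: (mulfI p_neq0); apply: (eq_of_multiple (k := -1) Qu); ring.
Qed.

Lemma param_quadraticN1 : half_D = 0 -> param_quadratic (-1) = 0.
Proof. by rewrite /param_quadratic => ->; ring. Qed.

Lemma special_solution_I_param : y1 + 2 * y2 + y3 = 0 ->
  special_solution_I y2 y3 = param_solution (-1).
Proof.
move=> /eqP; rewrite -addrA addr_eq0 => /eqP y1E.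
rewrite /special_solution_I /param_solution /half_diff /half_D y1E.
by congr col3; field.
Qed.

Lemma special_solution_II_param : y1 - 2 * y2 + y3 = 0 ->
  special_solution_II y2 y3 = param_solution (-1).
Proof.
move=> /eqP; rewrite -addrA addr_eq0 => /eqP y1E.
rewrite /special_solution_II /param_solution /half_diff /half_D y1E.
by congr col3; field.
Qed.

End ModelSolution.

(** * Complex critical points for real data *)

Lemma critical_pointP (R : realType) (y1 y2 y3 : R) (g : 'cV[R[i]]_3) :
  let z1 := real_complex R y1 in
  let z2 := real_complex R y2 in
  let z3 := real_complex R y3 in
  critical_point (col3 y1 y2 y3) g <->
  \det (Sigma g) != 0 /\
  exists u, param_quadratic z1 z2 z3 u = 0 /\ g = param_solution z1 z2 z3 u.
Proof.
rewrite /critical_point map_col3.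
by split=> -[det_neq0 sc0]; split=> //;
  exact/(score_eq0P _ _ _ det_neq0).
Qed.

Lemma critical_point_D0 (R : realType) (y1 y2 y3 : R) (g : 'cV[R[i]]_3) :
  let z1 := real_complex R y1 in
  let z2 := real_complex R y2 in
  let z3 := real_complex R y3 in
  D_poly z1 z2 z3 = 0 ->
  critical_point (col3 y1 y2 y3) g <->
  \det (Sigma g) != 0 /\ g = param_solution z1 z2 z3 (-1).
Proof.
move=> z1 z2 z3 D0; have q0 : half_D z1 z2 z3 = 0 by rewrite half_DE D0 mul0r.
apply: iff_trans (critical_pointP _ _ _ _) _.
split=> [[det_neq0 [u [Qu gE]]] | ].
  rewrite gE in det_neq0 *; split=> //.
  by rewrite (param_half_D0 q0 Qu det_neq0).
case=> det_neq0 gE; split=> //; exists (-1); split=> //.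
exact: param_quadraticN1.
Qed.

Lemma critical_point_D_neq0 (R : realType) (y1 y2 y3 : R) :
  let z1 := real_complex R y1 in
  let z2 := real_complex R y2 in
  let z3 := real_complex R y3 in
  D_poly z1 z2 z3 != 0 ->
  forall s : R[i], s ^+ 2 = delta_poly z1 z2 z3 -> forall g : 'cV[R[i]]_3,
  critical_point (col3 y1 y2 y3) g <->
  \det (Sigma g) != 0 /\
  (g = general_solution z1 z2 z3 s \/ g = general_solution z1 z2 z3 (- s)).
Proof.
move=> z1 z2 z3 D_neq0 s s2 g.
apply: iff_trans (critical_pointP _ _ _ _) _.
rewrite !general_solution_param //.
split=> -[det_neq0 sol]; split=> //.
  case: sol => u [/(param_quadratic_roots _ D_neq0 s2) uE ->].
  by case: uE => ->; [left | right].
by case: sol => ->; eexists; split=> //;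
  apply/(param_quadratic_roots _ D_neq0 s2); [left | right].
Qed.

(** * Counting the critical points for generic data *)

Lemma D_poly_rmorph (F F' : fieldType) (f : {rmorphism F -> F'})
    (y1 y2 y3 : F) :
  D_poly (f y1) (f y2) (f y3) = f (D_poly y1 y2 y3).
Proof. by rewrite /D_poly; ring. Qed.

Lemma delta_poly_rmorph (F F' : fieldType) (f : {rmorphism F -> F'})
    (y1 y2 y3 : F) :
  delta_poly (f y1) (f y2) (f y3) = f (delta_poly y1 y2 y3).
Proof. by rewrite /delta_poly; ring. Qed.

(** D and delta nonzero give two distinct roots u. The other two conditions say that p and p - q = 2
    (y2^2 - y1 y3) are nonzero, so that neither solution is singular. *)
Lemma has_2_critical_points (R : realType) (y1 y2 y3 : R) :
  D_poly y1 y2 y3 != 0 -> delta_poly y1 y2 y3 != 0 ->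
  y1 - y3 != 0 -> y2 ^+ 2 - y1 * y3 != 0 ->
  has_n_critical_points 2 (col3 y1 y2 y3).
Proof.
pose z1 := real_complex R y1; pose z2 := real_complex R y2.
pose z3 := real_complex R y3 => D_neq0 delta_neq0 y13 y213.
have Dz : D_poly z1 z2 z3 != 0 by rewrite D_poly_rmorph fmorph_eq0.
have dz : delta_poly z1 z2 z3 != 0 by rewrite delta_poly_rmorph fmorph_eq0.
have p_neq0 : half_diff z1 z3 != 0.
  rewrite /half_diff -rmorphB mulf_neq0 ?invr_eq0 ?pnatr_eq0 //.
  by rewrite sqrf_eq0 fmorph_eq0.
have q_neq0 : half_D z1 z2 z3 != 0.
  by rewrite half_DE mulf_neq0 ?invr_eq0 ?pnatr_eq0.
have pq_neq0 : half_diff z1 z3 - half_D z1 z2 z3 != 0.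
  have -> : half_diff z1 z3 - half_D z1 z2 z3 = 2 * (z2 ^+ 2 - z1 * z3).
    by rewrite /half_diff /half_D; field.
  by rewrite -rmorphXn -rmorphM -rmorphB mulf_neq0 ?pnatr_eq0 // fmorph_eq0.
pose s := sqrtC (delta_poly z1 z2 z3).
have s2 : s ^+ 2 = delta_poly z1 z2 z3 by rewrite sqrtCK.
have s_neq0 : s != 0 by rewrite sqrtC_eq0.
have det_neq0 (r : R[i]) : r ^+ 2 = delta_poly z1 z2 z3 ->
    \det (Sigma (general_solution z1 z2 z3 r)) != 0.
  move=> r2; rewrite general_solution_param //.
  apply: det_param_solution_neq0 => //.
  by apply/(param_quadratic_roots _ Dz r2); left.
exists [:: general_solution z1 z2 z3 s; general_solution z1 z2 z3 (- s)].
split=> // [|g].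
  rewrite /= andbT inE; apply: contraNneq s_neq0.
  rewrite !general_solution_param // => gE.
  (* The difference of coordinates 0 and 2 is affine in u with slope q/3, so it separates the two
     roots, which differ by 2s/D. *)
  have := congr2 (fun g h : 'cV[R[i]]_3 => g 0 0 - h 2 0) gE gE.
  rewrite !param_solution_sub => sE.
  apply/eqP/(mulfI q_neq0).
  apply: (eq_of_multiple (k := 3 * D_poly z1 z2 z3 / 2) sE); field.
  by rewrite Dz.
apply: iff_trans (critical_point_D_neq0 Dz s2 g) _.
rewrite !inE; split=> [[_ gE] | /orP gE].
  by case: gE => ->; rewrite eqxx ?orbT.
have {}gE : g = general_solution z1 z2 z3 s \/
            g = general_solution z1 z2 z3 (- s).
  by case: gE => /eqP; [left | right].
by split=> //; case: gE => ->; apply: det_neq0; rewrite ?sqrrN.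
Qed.

Lemma implicit_ml_degree_2 (R : realType) : implicit_ml_degree_is R 2.
Proof.
pose x (i : 'I_3) : {mpoly R[3]} := 'X_i.
pose D := (x 0 - 2 * x 1 + x 2) * (x 0 + 2 * x 1 + x 2).
pose delta := x 0 ^+ 4 - 4 * x 0 ^+ 2 * x 1 ^+ 2 + x 1 ^+ 4
  + 6 * x 0 * x 1 ^+ 2 * x 2 - x 0 ^+ 2 * x 2 ^+ 2
  - 4 * x 1 ^+ 2 * x 2 ^+ 2 + x 2 ^+ 4.
(* The exceptional set is the hypersurface [p] = 0, where one of the four nonvanishing conditions
   fails. *)
pose p := D * delta * (x 0 - x 2) * (x 1 ^+ 2 - x 0 * x 2).
have pE (y : 'cV[R]_3) : p.@[fun i => y i 0] =
    D_poly (y 0 0) (y 1 0) (y 2 0) * delta_poly (y 0 0) (y 1 0) (y 2 0)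
    * (y 0 0 - y 2 0) * (y 1 0 ^+ 2 - y 0 0 * y 2 0).
  rewrite /p /D /delta /x !(rmorphM, rmorphB, rmorphD, rmorphXn, rmorph1) /=.
  rewrite !mevalXU.
  by rewrite /D_poly /delta_poly; ring.
rewrite /implicit_ml_degree_is /generically.
exists (fun y => p.@[fun i => y i 0] = 0); split.
- exists [:: p] => y; split=> [py0 _ /[1!inE] /eqP -> // | ].
  by apply; rewrite inE.
(* At (1, 0, 2) the four factors are 9, 13, -1 and -2. *)
- exists (col3 1 0 2); rewrite pE !mxE /= /D_poly /delta_poly.
  by apply/eqP; rewrite (_ : _ * _ = 234) ?pnatr_eq0 //; ring.
move=> y /eqP; rewrite pE !mulf_eq0 -!orbA !negb_or.
case/and5P=> D1_neq0 D2_neq0 delta_neq0 y13_neq0 y213_neq0.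
by rewrite [y]col3_eta; apply: has_2_critical_points; first exact: mulf_neq0.
Qed.

Theorem theorem3p1 (R : realType) :
  implicit_ml_degree_is R 2 /\
  forall y1 y2 y3 : R,
    let crit := critical_point (col3 y1 y2 y3) in
    let z1 := real_complex R y1 in
    let z2 := real_complex R y2 in
    let z3 := real_complex R y3 in
    [/\ D_poly y1 y2 y3 != 0 ->
          forall sqrt_delta : R[i], sqrt_delta ^+ 2 = delta_poly z1 z2 z3 ->
          forall g : 'cV[R[i]]_3,
            crit g <->
            \det (Sigma g) != 0 /\
            (g = general_solution z1 z2 z3 sqrt_delta \/
             g = general_solution z1 z2 z3 (- sqrt_delta)),
        y1 + 2 * y2 + y3 = 0 ->
          forall g : 'cV[R[i]]_3,
            crit g <->
            \det (Sigma g) != 0 /\ g = special_solution_I z2 z3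
      & y1 - 2 * y2 + y3 = 0 ->
          forall g : 'cV[R[i]]_3,
            crit g <->
            \det (Sigma g) != 0 /\ g = special_solution_II z2 z3].
Proof.
split=> [|y1 y2 y3 crit z1 z2 z3]; first exact: implicit_ml_degree_2.
split=> [D_neq0 | y0 g | y0 g].
- by apply: critical_point_D_neq0; rewrite D_poly_rmorph fmorph_eq0.
- have z0 : z1 + 2 * z2 + z3 = 0.
    by rewrite -(rmorph_nat (real_complex R)) -rmorphM -!rmorphD y0 rmorph0.
  rewrite (special_solution_I_param z0); apply: critical_point_D0.
  by rewrite /D_poly -/z1 -/z2 -/z3 z0 mulr0.
- have z0 : z1 - 2 * z2 + z3 = 0.
    rewrite -(rmorph_nat (real_complex R)) -rmorphM -rmorphB -rmorphD y0.
    exact: rmorph0.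
  rewrite (special_solution_II_param z0); apply: critical_point_D0.
  by rewrite /D_poly -/z1 -/z2 -/z3 z0 mul0r.
Qed.
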